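(* Let $A$ be a finite set of prisoners with $|A|\ge2$, let $K$ be an infinite set of colors, let $V$ be a visibility graph on $A$, and let $I$ be an inning function on $A$ with $IN\ge2$. Suppose the hat game $\mathcal{G}=(A,K,V,I)$ satisfies: (S1) $|I_1|=1$; (S4) every prisoner $a\in I_1$ satisfies $V(a)=A\setminus\{a\}$. Then there is a predictor for $\mathcal{G}$ such that for every coloring, at most one prisoner guesses incorrectly.
   Context: A hat game $(A,K,V,I)$ consists of: a set $A$ of prisoners and a set $K$ of colors (with $|A|,|K|\ge2$); a visibility graph $V\subseteq A^2$ with no loops, where $(a,b)\in V$ means $a$ sees $b$'s hat, and $V(a)=\{b:(a,b)\in V\}$; and an inning function $I$, a surjection from $A$ onto $\{\beta:1\le\beta\le\alpha\}$ for some nonzero ordinal $\alpha$. Write $IN=\max\operatorname{ran}(I)$, $I_\beta=\{a:I(a)=\beta\}$, and $H(a)=\{b:I(b)<I(a)\}$. A coloring is $f\in K^A$. Strategies: for each $a$, a function $S_a:K^{H(a)}\times K^{V(a)}\to K$; guesses are defined by recursion on $I(a)$ as $\sigma_a(f)=S_a(h_a^f,f\restriction V(a))$ with $h_a^f=(\sigma_b(f))_{b\in H(a)}$. A predictor is $P:K^A\to K^A$ with $P(f)(a)=\sigma_a(f)$ for some family of strategies. Prisoner $a$ guesses incorrectly under $f$ if $P(f)(a)\ne f(a)$. *)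

(* Defs.v *)
From mathcomp Require Import all_boot.
From mathcomp Require Import boolp classical_sets cardinality.

Set Implicit Arguments.
Unset Strict Implicit.
Unset Printing Implicit Defensive.

Local Open Scope set_scope.

Definition visibility_graph (A : finType) (V : rel A) : Prop := irreflexive V.

Definition visible (A : finType) (V : rel A) (a : A) : {set A} :=
  [set b | V a b].

(* In general innings are the ordinals 1 <= beta <= alpha.  The set A is finite
   here, so a surjection from A onto them forces alpha to be finite; hence
   innings are natural numbers. *)
Definition inning_function (A : finType) (I : A -> nat) : Prop :=
  exists2 alpha : nat, alpha != 0 &
    forall beta : nat, (exists a : A, I a = beta) <-> 1 <= beta <= alpha.

Definition last_inning (A : finType) (I : A -> nat) : nat := \max_(a : A) I a.

Definition inning_class (A : finType) (I : A -> nat) (beta : nat) : {set A} :=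
  [set a | I a == beta].

Definition heard (A : finType) (I : A -> nat) (a : A) : {set A} :=
  [set b | I b < I a].

Definition coloring (A : finType) (K : Type) : Type := A -> K.

Definition strategies (A : finType) (K : Type) (V : rel A) (I : A -> nat) :
    Type :=
  forall a : A,
    ({b : A | b \in heard I a} -> K) * ({b : A | b \in visible V a} -> K) -> K.

Lemma wf_heard (A : finType) (I : A -> nat) :
  well_founded (fun b a : A => b \in heard I a).
Proof.
move=> a; have [n] := ubnP (I a); elim: n a => [a|n IHn a].
  by rewrite ltn0; discriminate.
rewrite ltnS => le_an; constructor=> b; rewrite inE => lt_ba.
by apply: IHn; apply: leq_trans le_an.
Qed.

(* guess S f a is sigma_a(f), defined by well-founded recursion on I a. *)
Definition guess (A : finType) (K : Type) (V : rel A) (I : A -> nat)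
    (S : strategies K V I) (f : coloring A K) : A -> K :=
  Fix (@wf_heard A I) (fun _ : A => K)
    (fun a (h : forall b : A, b \in heard I a -> K) =>
       S a (fun b => h (sval b) (svalP b), fun b => f (sval b))).

Lemma guessE (A : finType) (K : Type) (V : rel A) (I : A -> nat)
    (S : strategies K V I) (f : coloring A K) (a : A) :
  guess S f a = S a (fun b => guess S f (sval b), fun b => f (sval b)).
Proof.
rewrite /guess Fix_eq // => {}a g h gh; congr (S a (_, _)).
by apply/funext => b; exact: gh.
Qed.

Definition is_predictor (A : finType) (K : Type) (V : rel A) (I : A -> nat)
    (P : coloring A K -> coloring A K) : Prop :=
  exists S : strategies K V I, forall f a, P f a = guess S f a.

Definition incorrect (A : finType) (K : Type)
    (P : coloring A K -> coloring A K) (f : coloring A K) : {set A} :=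
  [set a | `[< P f a <> f a >]].

(* Main.v *)
Require Import Defs.
From mathcomp Require Import all_boot.
From mathcomp Require Import boolp classical_sets functions cardinality.

Set Implicit Arguments.
Unset Strict Implicit.
Unset Printing Implicit Defensive.

(** The unique prisoner of the first inning sees every other hat and everybody
else hears that guess. For [K] infinite, [K ^ A] injects into [K], so the first
guess can be a code of the colors of all the other hats; the other prisoners
decode it, and only the first one can be wrong. The injection comes from an
injection [K * K -> K], obtained by applying Zorn's lemma to the injections
[D * D -> D] with [D] a subset of [K]: a maximal [D] has a complement that
injects into [D]. *)

(** * Comparison of two sets by injections *)

Section Comparability.
Local Open Scope classical_set_scope.

(** Zorn's lemma gives a maximal graph [G] of a partial injection from [A] to [B]; it is total on
    [A] or onto [B], and in the second case its inverse is the map sought. The points [t0] and [u0]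
    are default values outside [B] and [A]. *)
Lemma comparable_injections (T U : Type) (t0 : T) (u0 : U)
    (A : set T) (B : set U) :
  (exists2 f : T -> U, set_fun A B f & set_inj A f) \/
  (exists2 g : U -> T, set_fun B A g & set_inj B g).
Proof.
pose partial_inj (G : set (T * U)) :=
  [/\ forall x y, G (x, y) -> A x /\ B y,
      forall x y y', G (x, y) -> G (x, y') -> y = y'
    & forall x x' y, G (x, y) -> G (x', y) -> x = x'].
have [F FP totF|G [[GAB Gfun Ginj] Gmax]] := @Zorn_bigcup _ partial_inj.
  split.
  - by move=> x y [G FG Gxy]; have [GAB _ _] := FP G FG; exact: GAB.
  - move=> x y y' [G FG Gxy] [G' FG' Gxy'].
    have [_ Gfun _] := FP G FG; have [_ Gfun' _] := FP G' FG'.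
    by have [/(_ _ Gxy)|/(_ _ Gxy')] := totF G G' FG FG' => ?;
       [exact: Gfun' Gxy'|exact: Gfun Gxy _].
  - move=> x x' y [G FG Gxy] [G' FG' Gxy'].
    have [_ _ Ginj] := FP G FG; have [_ _ Ginj'] := FP G' FG'.
    by have [/(_ _ Gxy)|/(_ _ Gxy')] := totF G G' FG FG' => ?;
       [exact: Ginj' Gxy'|exact: Ginj Gxy _].
have [domG|] := pselect (forall x, A x -> exists y, G (x, y)).
  left; have [x|f Gf] := @choice _ _ (fun x y => A x -> G (x, y)).
    have [/domG[y Gxy]|nAx] := pselect (A x).
      by exists y.
    by exists u0.
  exists f => [x /Gf /GAB[]//|x x' /set_mem/Gf Gx /set_mem/Gf Gx' ff'].
  by apply: Ginj Gx _; rewrite ff'.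
move=> /existsNP[x /not_implyP[Ax /forallNP Gx]].
have [ranG|] := pselect (forall y, B y -> exists x, G (x, y)).
  right; have [y|g Gg] := @choice _ _ (fun y x => B y -> G (x, y)).
    have [/ranG[z Gzy]|nBy] := pselect (B y).
      by exists z.
    by exists t0.
  exists g => [y /Gg /GAB[]//|y y' /set_mem/Gg Gy /set_mem/Gg Gy' gg'].
  by apply: Gfun Gy _; rewrite gg'.
move=> /existsNP[y /not_implyP[By /forallNP Gy]].
(* As [x] and [y] are both unmatched, adding [(x, y)] to [G] contradicts maximality. *)
case: (Gmax (G `|` [set (x, y)])).
  split=> [|/(_ (x, y))]; first exact: subsetUl.
  by move=> /(_ (or_intror erefl)); exact: Gx.
split.
- by move=> x' y' [/GAB//|[-> ->]].
- move=> x' y' y'' [Gy'|[-> ->]] [Gy''|[]]; first exact: Gfun Gy' Gy''.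
  + by move=> E; case: (Gx y'); rewrite -E.
  + by case: (Gx y'').
  + by [].
- move=> x' x'' y' [Gx'|[-> ->]] [Gx''|[]]; first exact: Ginj Gx' Gx''.
  + by move=> _ E; case: (Gy x'); rewrite -E.
  + by case: (Gy x'').
  + by move=> ->.
Qed.

End Comparability.

(** * An injection from pairs of colors to colors *)

Section Pairing.
Local Open Scope classical_set_scope.
Variable K : Type.

(** The map [p] is total on [K], which avoids subtypes; only its values on [D] matter. *)
Definition pairing_on (D : set K) (p : K -> K -> K) : Prop :=
  (forall x y, D x -> D y -> D (p x y)) /\
  (forall x y x' y', D x -> D y -> D x' -> D y' ->
     p x y = p x' y' -> x = x' /\ y = y').

(* [d0] and [d1] tag the two parts [D] and [D' `\` D] of [D']. *)
Lemma pairing_absorb (D D' : set K) (p : K -> K -> K) (r : K -> K) (d0 d1 : K) :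
  pairing_on D p -> D d0 -> D d1 -> d0 <> d1 ->
  set_fun (D' `\` D) D r -> set_inj (D' `\` D) r ->
  exists2 j : K -> K, set_fun D' D j & set_inj D' j.
Proof.
move=> [pD pI] Dd0 Dd1 d01 rD rI.
exists (fun x => if pselect (D x) then p x d0 else p (r x) d1).
  move=> x D'x; case: pselect => Dx; apply: pD => //; exact: rD.
move=> x y /set_mem D'x /set_mem D'y.
case: pselect => Dx; case: pselect => Dy /pI[]//; try exact: rD.
- by move=> _ /esym.
- by move=> + _; apply: rI; rewrite inE.
Qed.

(** This is what contradicts maximality: a copy of [D] in its complement leaves room for the codes
    of the new pairs. *)
Lemma pairing_extend (D : set K) (p : K -> K -> K) (e : K -> K) (d0 d1 : K) :
  pairing_on D p -> D d0 -> D d1 -> d0 <> d1 ->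
  set_fun D (~` D) e -> set_inj D e ->
  exists D' p', [/\ pairing_on D' p', D `<=` D', ~ (D' `<=` D) &
    forall x y, D x -> D y -> p x y = p' x y].
Proof.
move=> Pp Dd0 Dd1 d01 eD eI; have [pD pI] := Pp.
pose D' := D `|` e @` D.
(* Pairs outside [D * D] are coded in [D] through [j], then moved to [e @` D],
   which is disjoint from the range of [p]. *)
have [y|r re] := @choice _ _ (fun y x => (D' `\` D) y -> D x /\ e x = y).
  have [[[//|[x Dx <-]] _]|] := pselect ((D' `\` D) y).
    by exists x.
  by exists d0.
have [||j jD jI] := pairing_absorb (r := r) (D' := D') Pp Dd0 Dd1 d01.
- by move=> y /re[].
- by move=> y y' /set_mem/re[_ ry] /set_mem/re[_ ry'] rr; rewrite -ry rr.
exists D', (fun x y => if `[< D x /\ D y >] then p x y else e (p (j x) (j y))).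
split; [split| |move=> /(_ (e d0))|].
- move=> x y D'x D'y; case: asboolP => [[Dx Dy]|_]; first by left; exact: pD.
  by right; exists (p (j x) (j y)) => //; apply: pD; exact: jD.
- move=> x y x' y' D'x D'y D'x' D'y'.
  case: asboolP => [[Dx Dy]|_]; case: asboolP => [[Dx' Dy']|_].
  + exact: pI.
  + by move=> E; case: (eD (p (j x') (j y'))); [apply: pD; exact: jD|];
       rewrite -E; exact: pD.
  + by move=> E; case: (eD (p (j x) (j y))); [apply: pD; exact: jD|];
       rewrite E; exact: pD.
  + move: D'x D'y D'x' D'y' => /[dup]/jD Dx D'x /[dup]/jD Dy D'y.
    move=> /[dup]/jD Dx' D'x' /[dup]/jD Dy' D'y'.
    move=> /(eI _ _ (mem_set (pD _ _ Dx Dy)) (mem_set (pD _ _ Dx' Dy'))).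
    move=> /(pI _ _ _ _ Dx Dy Dx' Dy')[].
    move=> /(jI _ _ (mem_set D'x) (mem_set D'x')) ->.
    by move=> /(jI _ _ (mem_set D'y) (mem_set D'y')) ->.
- by left.
- by move=> H; apply: (eD d0) => //; apply: H; right; exists d0.
- by move=> x y Dx Dy; case: asboolP => // -[].
Qed.

(** Only a preorder, since values outside the domain are not compared. *)
Definition pairing_le (s t : set K * (K -> K -> K)) : Prop :=
  s.1 `<=` t.1 /\ forall x y, s.1 x -> s.1 y -> s.2 x y = t.2 x y.

(** The bound lives on the union of the domains. Any two of its points lie in one member of the
    chain, and all members containing both give the same code. *)
Lemma pairing_chain (C : set (set K * (K -> K -> K))) :
  (forall s, C s -> pairing_on s.1 s.2) -> total_on C pairing_le ->
  exists2 t, pairing_on t.1 t.2 & forall s, C s -> pairing_le s t.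
Proof.
move=> CP Ctot.
have [[x y]|p pE] := @choice _ _ (fun (xy : K * K) (z : K) =>
    forall s, C s -> s.1 xy.1 -> s.1 xy.2 -> z = s.2 xy.1 xy.2).
  have [[s [Cs sx sy]]|nC] := pselect (exists s, [/\ C s, s.1 x & s.1 y]).
    exists (s.2 x y) => s' Cs' s'x s'y.
    by have [[_ E]|[_ E]] := Ctot _ _ Cs Cs'; [exact: E|symmetry; exact: E].
  by exists x => s Cs sx sy; case: nC; exists s.
have common x y : (\bigcup_(s in C) s.1) x -> (\bigcup_(s in C) s.1) y ->
    exists s, [/\ C s, s.1 x & s.1 y].
  move=> [s Cs sx] [s' Cs' s'y].
  by have [[ss' _]|[s's _]] := Ctot _ _ Cs Cs'; [exists s'|exists s];
     split=> //; [exact: ss'|exact: s's].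
exists (\bigcup_(s in C) s.1, fun x y => p (x, y)) => /=; last first.
  move=> s Cs; split=> /= [x sx|x y sx sy]; first by exists s.
  by rewrite (pE _ s).
split=> [x y Ux Uy|x y x' y' Ux Uy Ux' Uy'].
  have [s [Cs sx sy]] := common _ _ Ux Uy; rewrite (pE _ s)//=.
  by exists s => //; have [+ _] := CP s Cs; apply.
have [s [Cs sx sy]] := common _ _ Ux Uy.
have [s' [Cs' sx' sy']] := common _ _ Ux' Uy'.
rewrite (pE _ s)//= (pE (x', y') s')//=.
have [[ss' E]|[s's E]] := Ctot _ _ Cs Cs'.
  rewrite E//; have [_] := CP s' Cs'; apply=> //; exact: ss'.
rewrite (E x')//; have [_] := CP s Cs; apply=> //; exact: s's.
Qed.

Hypothesis infK : infinite_set [set: K].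

(** The starting point for Zorn's lemma: a copy of [nat] in [K], where [pickle] codes pairs. *)
Lemma pairing_countable : exists D p (d0 d1 : K),
  [/\ pairing_on D p, D d0, D d1 & d0 <> d1].
Proof.
have [f fI] : exists f : nat -> K, injective f.
  move/infiniteP/card_leP: infK => -[f].
  exists (fun n => set_val (f (SigSub (mem_set I : n \in setT)))) => m n.
  by move=> /val_inj /inj; rewrite !inE => /(_ I I) [].
have [x|g gK] := @choice _ _ (fun x n => range f x -> f n = x).
  by have [[n _ <-]|] := pselect (range f x); [exists n|exists 0%N].
exists (range f), (fun x y => f (pickle (g x, g y))), (f 0%N), (f 1%N).
split; [|by exists 0%N|by exists 1%N|by move/fI].
split=> [x y _ _|x y x' y' fx fy fx' fy' /fI /(pcan_inj pickleK)[gx gy]].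
  by exists (pickle (g x, g y)).
by rewrite -(gK x)// gx gK// -(gK y)// gy gK.
Qed.

Lemma infinite_pairing : exists p : K -> K -> K,
  forall x y x' y', p x y = p x' y' -> x = x' /\ y = y'.
Proof.
have [D [p [d0 [d1 [Pp Dd0 Dd1 d01]]]]] := pairing_countable.
(* Only extensions of [(D, p)] are considered, so that a maximal one still contains the tags [d0]
   and [d1]. *)
pose ok s := pairing_on s.1 s.2 /\ pairing_le (D, p) s.
pose R (s t : {s | ok s}) := `[< pairing_le (sval s) (sval t) >].
have le_refl s : pairing_le s s by split.
have le_trans s t u : pairing_le s t -> pairing_le t u -> pairing_le s u.
  move=> [st Est] [tu Etu]; split=> [|x y sx sy]; first exact: subset_trans tu.
  by rewrite Est// Etu//; exact: st.
have s0 : ok (D, p) by split.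
have [s||A Atot|m mmax] := ZL_preorder (exist _ _ s0) (R := R).
- exact/asboolP.
- move=> s t u /asboolP st /asboolP tu.
  by apply/asboolP; exact: le_trans st tu.
- have [|s s' [a Aa <-] [b Ab <-]|t Pt At] :=
    @pairing_chain [set sval s | s in A].
  + by move=> _ [[s [Ps ?]] _ <-].
  + by have [/asboolP|/asboolP] := Atot _ _ Aa Ab; [left|right].
  (* The union of the empty chain does not extend [(D, p)]; [(D, p)] itself bounds that chain. *)
  have [[a Aa]|A0] := pselect (exists a, A a); last first.
    by exists (exist _ _ s0) => s As; case: A0; exists s.
  have okt : ok t.
    split=> //; apply: (le_trans _ (sval a)); first by case: a {Aa} => a [].
    by apply: At; exists a.
  by exists (exist _ _ okt) => s As; apply/asboolP/At; exists s.
have [Pq Dm] := svalP m; have [DE _] := Dm.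
set E := (sval m).1 in Pq DE; set q := (sval m).2 in Pq.
have {Dd0 Dd1} [Ed0 Ed1] : E d0 /\ E d1 by split; exact: DE.
have [[e eE eI]|[r rE rI]] := comparable_injections d0 d0 E (~` E).
  have [E' [q' [Pq' EE' nE'E Eq']]] := pairing_extend Pq Ed0 Ed1 d01 eE eI.
  have mE' : pairing_le (sval m) (E', q') by split.
  have okE' : ok (E', q') by split=> //; exact: le_trans Dm mE'.
  have /asboolP[E'E _] := mmax (exist _ _ okE') (asboolT mE').
  by case: nE'E.
(* Here the complement of [E] injects into [E], hence so does all of [K], and [q] is pulled back
   along [j]. *)
have [||j jE jI] := pairing_absorb (D' := setT) (r := r) Pq Ed0 Ed1 d01.
- by rewrite setTD.
- by rewrite setTD.
exists (fun x y => q (j x) (j y)) => x y x' y'.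
have [_ qI] := Pq; move=> /qI[]; try exact: jE.
move=> /(jI _ _ (mem_set I) (mem_set I)) ->.
by move=> /(jI _ _ (mem_set I) (mem_set I)) ->.
Qed.

(** Folding [p] over the list of values is injective because all these lists have the same
    length. *)
Lemma infinite_fun_code (A : finType) : exists c : (A -> K) -> K, injective c.
Proof.
have [x0 _] := infinite_setN0 infK.
have [p pI] := infinite_pairing.
exists (fun f => foldr p x0 [seq f a | a <- enum A]) => f g fg.
suff /eq_in_map fgE : [seq f a | a <- enum A] = [seq g a | a <- enum A].
  by apply/funext => a; apply: fgE; rewrite mem_enum.
by elim: (enum A) fg => //= a s IHs /pI[-> /IHs ->].
Qed.

End Pairing.

(** * The coding strategy for the hat game *)

Theorem theorem4p4 (A : finType) (K : Type) (V : rel A) (I : A -> nat)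
    (hA : 2 <= #|A|) (hK : infinite_set [set: K]%classic)
    (hV : visibility_graph V) (hI : inning_function I)
    (hIN : 2 <= last_inning I)
    (S1 : #|inning_class I 1| = 1)
    (S4 : forall a : A, a \in inning_class I 1 -> visible V a = [set: A] :\ a) :
  exists P : coloring A K -> coloring A K,
    is_predictor V I P /\
    forall f : coloring A K, #|incorrect P f| <= 1.
Proof.
have /cards1P[a0 I1] : #|inning_class I 1| == 1 by rewrite S1.
(* Innings start at 1 and [a0] is alone in inning 1, so everybody else guesses later. *)
have heard0 b : b != a0 -> a0 \in heard I b.
  have [alpha _ Ialpha] := hI.
  have I0 : I a0 = 1 by apply/eqP; have := set11 a0; rewrite -I1 inE.
  move=> bNa0; rewrite inE I0 ltn_neqAle eq_sym.
  have /Ialpha/andP[-> _] : exists a, I a = I b by exists b.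
  by move: bNa0; rewrite -finset.in_set1 -I1 inE => ->.
have [x0 _] := infinite_setN0 hK.
have [c cI] := infinite_fun_code hK A.
(* The decoder [d] is a left inverse of [c]. *)
have [z|d dK] := @choice _ _ (fun z f => forall g : A -> K, c g = z -> g = f).
  have [[f <-]|nf] := pselect (exists f, c f = z); first by exists f => g /cI.
  by exists (fun _ => x0) => g gz; case: nf; exists g.
(* Partial information on [B] becomes a coloring of [A], with [x0] off [B]. *)
pose extend (B : {set A}) (v : {b | b \in B} -> K) b := oapp v x0 (insub b).
have extendE (B : {set A}) (g : A -> K) b :
  b \in B -> extend B (fun a => g (sval a)) b = g b.
  by move=> bB; rewrite /extend insubT.
pose S : strategies K V I := fun a hv =>
  if a == a0 then c (extend _ hv.2) else d (extend _ hv.1 a0) a.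
exists (guess S); split; first by exists S.
move=> f; rewrite -(cards1 a0) subset_leq_card//; apply/fintype.subsetP => b.
rewrite !inE => /asboolP/asboolP; apply: contra_notT => bNa0.
rewrite guessE /S (negbTE bNa0) -/S (extendE _ (guess S f)) ?heard0//.
(* Decoding the first guess gives [f] with [x0] in place of the color of [a0], which is right at [b]
   since [b] differs from [a0]. *)
rewrite guessE {1}/S eqxx -(dK _ _ erefl) (extendE _ f)//.
by rewrite S4 ?I1 !inE ?eqxx// bNa0.
Qed.
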